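(* Let $K$ be a compact Hausdorff space, and let $\varphi\in(\mathrm{C}(K)^\delta)^\ast$, identified with a measure in $\mathrm{M}(\Sigma^{\mathcal{C}}_K,\mathcal{N}_K)$. Then $\varphi$ is order continuous (as a functional on $\mathrm{C}(K)^\delta$) if and only if $\varphi$ is countably additive and regular on $\Sigma^{\mathcal{C}}_K$ (as a measure).
   Context: $\mathrm{C}(K)^\delta$ is the Dedekind completion of the Banach lattice $\mathrm{C}(K)$ of continuous real-valued functions on $K$: the unique (up to linear lattice isometry) Dedekind complete Banach lattice containing $\mathrm{C}(K)$ as a majorizing, order dense (isometrically embedded) sublattice. $\mathcal{N}_K$ is the collection of meagre subsets of $K$, and $\Sigma^{\mathcal{C}}_K=\{U\Delta N: U\subseteq K\text{ open},\ N\in\mathcal{N}_K\}$ is the $\sigma$-algebra of sets with the property of Baire. $\mathrm{L}^\infty(\Sigma^{\mathcal{C}}_K,\mathcal{N}_K)$ is the vector lattice of bounded real-valued $\Sigma^{\mathcal{C}}_K$-measurable functions on $K$ modulo the ideal of those vanishing off a meagre set; the class of $u$ is $\hat u$, so $\hat f\le\hat g$ iff $\{x: f(x)>g(x)\}\in\mathcal{N}_K$, and the norm is $\|\hat f\|_\infty=\inf\{c\ge0:\{x:|f(x)|>c\}\in\mathcal{N}_K\}$. $\mathrm{C}(K)^\delta$ is identified with $\mathrm{L}^\infty(\Sigma^{\mathcal{C}}_K,\mathcal{N}_K)$ via $\mathrm{C}(K)\ni u\mapsto\hat u$. $\mathrm{M}(\Sigma^{\mathcal{C}}_K,\mathcal{N}_K)$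 is the Banach lattice of bounded finitely additive signed measures $\mu$ on $\Sigma^{\mathcal{C}}_K$ with $\mu(N)=0$ for all $N\in\mathcal{N}_K$ (setwise order, total variation norm). The dual $(\mathrm{C}(K)^\delta)^\ast$ is identified with $\mathrm{M}(\Sigma^{\mathcal{C}}_K,\mathcal{N}_K)$ via the isometric lattice isomorphism determined by $\varphi(\hat u)=\int_K u\,d\varphi$, so that $\varphi(A)=\varphi(\hat{\mathbf 1}_A)$ for $A\in\Sigma^{\mathcal{C}}_K$; the same symbol is used for the functional and the measure. A norm bounded (equivalently order bounded) functional $\varphi$ on a Banach lattice $E$ is order continuous if $\inf\{|\varphi(f)|:f\in D\}=0$ for every downward directed set $D\subseteq E$ with infimum $0$. A positive $\varphi\in\mathrm{M}(\Sigma^{\mathcal{C}}_K,\mathcal{N}_K)$ is regular if for every $B\in\Sigma^{\mathcal{C}}_K$, $$\sup\{\varphi(C):C\subseteq B\text{ compact}\}=\varphi(B)=\inf\{\varphi(U):U\supseteq B\text{ open}\}.$$ A general $\varphi\in\mathrm{M}(\Sigma^{\mathcal{C}}_K,\mathcal{N}_K)$ is regular if $|\varphi|$ is regular. *)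

(* Defs.v *)
From HB Require Import structures.
From mathcomp Require Import all_boot all_order all_algebra.
From mathcomp Require Import all_classical all_reals all_analysis measurable_realfun.

Set Implicit Arguments.
Unset Strict Implicit.
Unset Printing Implicit Defensive.

Import Order.TTheory GRing.Theory Num.Theory.
Import numFieldNormedType.Exports.

Local Open Scope classical_set_scope.
Local Open Scope ring_scope.
Local Open Scope quotient_scope.

Section meagre_sets.
Context {K : topologicalType}.
Implicit Types A B U N : set K.

Definition nowhere_dense A := interior (closure A) = set0.

Definition meagre A := exists F : nat -> set K,
  (forall n, nowhere_dense (F n)) /\ A = \bigcup_n F n.

(* The sigma-algebra of sets with the property of Baire. *)
Definition baire_set A := exists U N, [/\ open U, meagre N & A = U `+` N].

Lemma nowhere_denseS A B : A `<=` B -> nowhere_dense B -> nowhere_dense A.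
Proof.
move=> AB B0; rewrite /nowhere_dense -subset0 -B0.
by apply: interiorS; exact: closureS.
Qed.

Lemma nowhere_dense0 : nowhere_dense set0.
Proof. by rewrite /nowhere_dense closure0 interior0. Qed.

Lemma meagreS A B : A `<=` B -> meagre B -> meagre A.
Proof.
move=> AB [F [F0 BF]]; exists (fun n => A `&` F n); split.
  by move=> n; apply: nowhere_denseS (F0 n); exact: subIsetr.
by rewrite -setI_bigcupr -BF setIidl.
Qed.

Lemma nowhere_dense_meagre A : nowhere_dense A -> meagre A.
Proof. by move=> A0; exists (fun=> A); split => //; rewrite bigcup_const. Qed.

Lemma meagre0 : meagre set0.
Proof. by apply: nowhere_dense_meagre; exact: nowhere_dense0. Qed.

Lemma meagre_bigcup (A : nat -> set K) :
  (forall n, meagre (A n)) -> meagre (\bigcup_n A n).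
Proof.
move=> /choice[F AF].
pose G k := if unpickle k is Some nm then F nm.1 nm.2 else set0.
exists G; split.
  move=> k; rewrite /G; case: unpickle => [[n m]|]; last exact: nowhere_dense0.
  by have [+ _] := AF n; exact.
apply/seteqP; split => x.
  move=> [n _]; have [_ ->] := AF n => -[m _ Fx].
  by exists (pickle (n, m)) => //; rewrite /G pickleK.
move=> [k _]; rewrite /G; case: unpickle => [[n m]|//] Fx.
by exists n => //; have [_ ->] := AF n; exists m.
Qed.

Lemma meagreU A B : meagre A -> meagre B -> meagre (A `|` B).
Proof.
move=> mA mB; rewrite -bigcup2E; apply: meagre_bigcup => -[|[|n]] //=.
exact: meagre0.
Qed.

Lemma baire_setP A : baire_set A <-> exists2 U, open U & meagre (A `+` U).
Proof.
split=> [[U [N [oU mN ->]]]|[U oU mAU]].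
  by exists U => //; rewrite setYC setYA setYK setYC setY0.
by exists U, (A `+` U); split => //; rewrite setYC -setYA setYK setY0.
Qed.

Lemma open_baire_set A : open A -> baire_set A.
Proof. by move=> oA; exists A, set0; split => //; [exact: meagre0|rewrite setY0]. Qed.

Lemma meagre_baire_set A : meagre A -> baire_set A.
Proof.
by move=> mA; exists set0, A; split => //; [exact: open0|rewrite setYC setY0].
Qed.

Lemma baire_setC A : baire_set A -> baire_set (~` A).
Proof.
move=> /baire_setP[U oU mAU]; apply/baire_setP; exists (interior (~` U)).
  exact: open_interior.
have mU : meagre (~` U `\` interior (~` U)).
  apply: nowhere_dense_meagre; rewrite /nowhere_dense -subset0.
  have cU : closed (~` U `\` interior (~` U)).
    by apply: closedI; [|apply: open_closedC; apply: open_interior];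
       rewrite closedC.
  have -> : closure (~` U `\` interior (~` U)) = ~` U `\` interior (~` U) by apply/esym/closure_id.
  move=> x xB.
  have [_ nx] := interior_subset xB.
  by apply: nx; apply: interiorS xB; exact: subDsetl.
apply: meagreS (meagreU mAU mU) => x; rewrite /setY /=.
have := @interior_subset _ (~` U) x.
by case: (pselect (A x)); case: (pselect (U x)) => /=; tauto.
Qed.

Lemma baire_set_bigcup (A : nat -> set K) :
  (forall n, baire_set (A n)) -> baire_set (\bigcup_n A n).
Proof.
move=> bA; have /choice[U AU] : forall n, exists U, open U /\ meagre (A n `+` U).
  by move=> n; have /baire_setP[U] := bA n; exists U.
apply/baire_setP; exists (\bigcup_n U n).
  by apply: bigcup_open => n _; exact: (AU n).1.
apply: (@meagreS _ (\bigcup_n (A n `+` U n))); last first.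
  by apply: meagre_bigcup => n; exact: (AU n).2.
move=> x [[[n _ Ax] nU]|[[n _ Ux] nA]]; exists n => //; [left|right]; split => //.
  by move=> Ux; apply: nU; exists n.
by move=> Ax; apply: nA; exists n.
Qed.

Lemma baire_set0 : baire_set set0.
Proof. exact/meagre_baire_set/meagre0. Qed.

Lemma baire_setT : baire_set [set: K].
Proof. exact/open_baire_set/openT. Qed.

Lemma baire_setU A B : baire_set A -> baire_set B -> baire_set (A `|` B).
Proof.
move=> bA bB; rewrite -bigcup2E; apply: baire_set_bigcup => -[|[|n]] //=.
exact: baire_set0.
Qed.

Lemma baire_setI A B : baire_set A -> baire_set B -> baire_set (A `&` B).
Proof.
move=> bA bB; rewrite -[A `&` B]setCK setCI.
by apply: baire_setC; apply: baire_setU; exact: baire_setC.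
Qed.

Lemma baire_setD A B : baire_set A -> baire_set B -> baire_set (A `\` B).
Proof. by move=> bA bB; rewrite setDE; apply: baire_setI => //; exact: baire_setC. Qed.

Lemma sigma_algebra_baire_set : sigma_algebra [set: K] baire_set.
Proof.
split; first exact: baire_set0; last exact: baire_set_bigcup.
by move=> A bA; rewrite setTD; exact: baire_setC.
Qed.

End meagre_sets.

Section bounded_baire_functions.
Context {R : realType} {K : topologicalType}.
Implicit Types (f g u v : K -> R) (A : set K) (B : set R).

Definition baire_measurable f :=
  forall B, measurable B -> baire_set (f @^-1` B).

Definition bounded_function f := exists M, forall x, `|f x| <= M.

Lemma baire_measurable_gt f :
  (forall a, baire_set [set x | a < f x]) -> baire_measurable f.
Proof.
move=> fa B mB; have {mB} : <<s @RGenOInfty.G R >> B.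
  by rewrite -[X in X B]RGenOInfty.measurableE.
suff : <<s @RGenOInfty.G R >> `<=` [set C | baire_set (f @^-1` C)] by apply.
apply: smallest_sub.
  split => [|C /= bC|C bC] /=.
  - exact: baire_set0.
  - by rewrite setTD preimage_setC; exact: baire_setC.
  - by rewrite preimage_bigcup; exact: baire_set_bigcup.
move=> _ [a ->] /=.
rewrite (_ : f @^-1` _ = [set x | a < f x]); first exact: fa.
by apply/seteqP; split => x /=; rewrite in_itv/= andbT.
Qed.

Lemma baire_measurable_lt f a :
  baire_measurable f -> baire_set [set x | a < f x].
Proof.
move=> mf; rewrite (_ : [set x | _] = f @^-1` `]a, +oo[).
  by apply: mf; exact: measurable_itv.
by apply/seteqP; split => x /=; rewrite in_itv/= andbT.
Qed.

Lemma baire_measurable_comp (h : R -> R) f :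
  measurable_fun setT h -> baire_measurable f -> baire_measurable (h \o f).
Proof.
move=> mh mf B mB; rewrite comp_preimage; apply: mf.
by rewrite -[X in measurable X]setTI; exact: mh.
Qed.

Lemma baire_measurableD f g :
  baire_measurable f -> baire_measurable g -> baire_measurable (f + g).
Proof.
move=> mf mg; apply: baire_measurable_gt => a.
pose F n := if @unpickle rat n is Some q then
  [set x | ratr q < f x] `&` [set x | a - ratr q < g x] else set0.
have FE q : F (pickle q) = [set x | ratr q < f x] `&` [set x | a - ratr q < g x].
  by rewrite /F pickleK.
rewrite (_ : [set x | _] = \bigcup_n F n).
  apply: baire_set_bigcup => n; rewrite /F; case: unpickle => [q|].
    by apply: baire_setI; exact: baire_measurable_lt.
  exact: baire_set0.
apply/seteqP; split => x /=.
  rewrite fctE -ltrBlDr => /rat_in_itvoo[q]; rewrite in_itv/= => /andP[q1 q2].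
  exists (pickle q); [exact: I|rewrite FE; split; first exact: q2].
  by rewrite /= ltrBlDr -ltrBlDl.
move=> [n _]; rewrite /F; case: unpickle => [q [/= q1 q2]|//].
by rewrite fctE -(subrKC (ratr q) a); exact: ltrD.
Qed.

Definition bbm_pred : {pred K -> R} :=
  [pred f | `[< baire_measurable f /\ bounded_function f >]].

Lemma bbm_submod_closed : submod_closed bbm_pred.
Proof.
split.
  apply/asboolP; split.
    apply: baire_measurable_gt => a; have [a0|a0] := ltP a 0.
      rewrite (_ : [set x | _] = setT); first exact: baire_setT.
      by apply/seteqP; split.
    rewrite (_ : [set x | _] = set0); first exact: baire_set0.
    by apply/seteqP; split => x //=; rewrite fctE ltNge a0.
  by exists 0 => x; rewrite normr0.
move=> c f g /asboolP[mf [M fM]] /asboolP[mg [N gN]]; apply/asboolP; split.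
  apply: baire_measurableD => //.
  by apply: (@baire_measurable_comp ( *%R c)) => //; exact: mulrl_measurable.
exists (`|c| * M + N) => x; rewrite fctE (le_trans (ler_normD _ _))// lerD//.
by rewrite /GRing.scale/= normrM ler_wpM2l.
Qed.

HB.instance Definition _ := GRing.isSubmodClosed.Build R (K -> R) bbm_pred
  bbm_submod_closed.

End bounded_baire_functions.

(* Bounded real functions measurable for the sets with the property of Baire. *)
Record bbm (R : realType) (K : topologicalType) := Bbm {
  bbm_fun :> K -> R ;
  bbm_funP : bbm_fun \in bbm_pred }.

Section bbm_quotient.
Context (R : realType) (K : topologicalType).
HB.instance Definition _ := [isSub for @bbm_fun R K].
HB.instance Definition _ := [Choice of bbm R K by <:].
HB.instance Definition _ := [SubChoice_isSubLmodule of bbm R K by <:].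
Implicit Types u v : bbm R K.

Lemma bbm_measurable u : baire_measurable u.
Proof. by have /asboolP[] := bbm_funP u. Qed.

Lemma bbm_bounded u : bounded_function u.
Proof. by have /asboolP[] := bbm_funP u. Qed.

Lemma bbmDE u v x : (u + v) x = u x + v x. Proof. by []. Qed.
Lemma bbmBE u v x : (u - v) x = u x - v x. Proof. by []. Qed.
Lemma bbmZE (c : R) u x : (c *: u) x = c * u x. Proof. by []. Qed.

Definition null_pred : {pred bbm R K} := [pred u : bbm R K | `[< meagre [set x | u x != 0] >]].

Lemma null_submod_closed : submod_closed null_pred.
Proof.
split.
  apply/asboolP; rewrite (_ : [set x | _] = set0); first exact: meagre0.
  by apply/seteqP; split => x //=; rewrite eqxx.
move=> c u v /asboolP mu /asboolP mv; apply/asboolP.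
apply: meagreS (meagreU mu mv) => x /= nz.
have {nz} : c * u x + v x != 0 by [].
case: (eqVneq (u x) 0) => [u0 nz|_ _]; last by left.
by right; rewrite u0 mulr0 add0r in nz.
Qed.

HB.instance Definition _ := GRing.isSubmodClosed.Build R (bbm R K) null_pred
  null_submod_closed.

(* Bounded Baire-property-measurable functions modulo those vanishing off a
   meagre set; for K compact Hausdorff, u |-> [u] makes it the Dedekind
   completion of C(K). *)
Definition Linfty := Quotient.quot null_pred.

HB.instance Definition _ := GRing.Zmodule.on Linfty.
HB.instance Definition _ := EqQuotient.on Linfty.
End bbm_quotient.
Arguments null_pred {R K}.

Section Linfty_theory.
Context {R : realType} {K : topologicalType}.
Local Notation E := (Linfty R K).
Implicit Types (u v w : bbm R K) (f g h : E) (c : R).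

Definition bbm_class u : E := \pi_E u.

Lemma bbm_class_eq u v :
  bbm_class u = bbm_class v <-> meagre [set x | u x != v x].
Proof.
have -> : (bbm_class u = bbm_class v) = (u - v \in null_pred) :> Prop.
  by rewrite Quotient.idealrBE; apply/propext; split => /eqP.
have -> : (u - v \in null_pred) = `[< meagre [set x | u x - v x != 0] >] by [].
rewrite (_ : [set x | u x - v x != 0] = [set x | u x != v x]).
  by split => /asboolP.
by apply/seteqP; split => x /=; rewrite subr_eq0.
Qed.

Lemma repr_class f : bbm_class (repr f) = f.
Proof. exact: reprK. Qed.

Lemma class_repr u : meagre [set x | repr (bbm_class u) x != u x].
Proof. by apply/bbm_class_eq; rewrite repr_class. Qed.

Lemma bbm_classD u v : bbm_class (u + v) = bbm_class u + bbm_class v.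
Proof. exact: Quotient.pi_add. Qed.

Lemma bbm_class0 : bbm_class 0 = 0.
Proof. by apply: (addrI (bbm_class 0)); rewrite -bbm_classD !addr0. Qed.

Definition Linfty_scale c f : E := bbm_class (c *: repr f).

Lemma Linfty_scaleE c u : Linfty_scale c (bbm_class u) = bbm_class (c *: u).
Proof.
apply/bbm_class_eq; apply: meagreS (class_repr u) => x /=.
by apply: contraNN => /eqP e; apply/eqP; exact: (congr1 ( *%R c) e).
Qed.

Lemma Linfty_scaleA a b f :
  Linfty_scale a (Linfty_scale b f) = Linfty_scale (a * b) f.
Proof. by rewrite -(repr_class f) !Linfty_scaleE scalerA. Qed.

Lemma Linfty_scale1 : left_id 1 Linfty_scale.
Proof. by move=> f; rewrite -(repr_class f) Linfty_scaleE scale1r. Qed.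

Lemma Linfty_scaleDr : right_distributive Linfty_scale +%R.
Proof.
move=> c f g; rewrite -(repr_class f) -(repr_class g).
by rewrite -bbm_classD !Linfty_scaleE scalerDr bbm_classD.
Qed.

Lemma Linfty_scaleDl f : {morph Linfty_scale^~ f : a b / a + b}.
Proof.
by move=> a b /=; rewrite -(repr_class f) !Linfty_scaleE scalerDl bbm_classD.
Qed.

HB.instance Definition _ := GRing.Zmodule_isLmodule.Build R E
  Linfty_scaleA Linfty_scale1 Linfty_scaleDr Linfty_scaleDl.

Lemma bbm_classZ c u : bbm_class (c *: u) = c *: bbm_class u.
Proof. by rewrite -Linfty_scaleE. Qed.

Definition Linfty_le f g := `[< meagre [set x | repr f x > repr g x] >].

Lemma Linfty_leP u v :
  Linfty_le (bbm_class u) (bbm_class v) <-> meagre [set x | u x > v x].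
Proof.
have mu := class_repr u; have mv := class_repr v.
split=> [/asboolP m|m]; [|apply/asboolP];
  apply: meagreS (meagreU m (meagreU mu mv)) => x /= uv;
  apply: contrapT => /not_orP[+ /not_orP[]]
     => + /negP/negPn/eqP a /negP/negPn/eqP b; apply.
- by rewrite a b.
- by rewrite -a -b.
Qed.

Lemma Linfty_le_refl : reflexive Linfty_le.
Proof.
move=> f; apply/asboolP; rewrite (_ : [set x | _] = set0); first exact: meagre0.
by apply/seteqP; split => x //=; rewrite ltxx.
Qed.

Lemma Linfty_le_anti : antisymmetric Linfty_le.
Proof.
move=> f g /andP[/asboolP fg /asboolP gf].
rewrite -(repr_class f) -(repr_class g); apply/bbm_class_eq.
by apply: meagreS (meagreU fg gf) => x /=; rewrite neq_lt => /orP[]; [right|left].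
Qed.

Lemma Linfty_le_trans : transitive Linfty_le.
Proof.
move=> g f h /asboolP fg /asboolP gh; apply/asboolP.
apply: meagreS (meagreU fg gh) => x /= hf.
by have [gf|gf] := ltP (repr g x) (repr f x); [left|right; exact: lt_le_trans gf].
Qed.

HB.instance Definition _ := Order.Le_isPOrder.Build ring_display E
  Linfty_le_refl Linfty_le_anti Linfty_le_trans.

Definition Linfty_norm f : R :=
  inf [set c | 0 <= c /\ meagre [set x | `|repr f x| > c]].

Lemma class_le u v : (bbm_class u <= bbm_class v) <-> meagre [set x | u x > v x].
Proof. exact: Linfty_leP. Qed.

Lemma Linfty_normE u : Linfty_norm (bbm_class u) =
  inf [set c | 0 <= c /\ meagre [set x | `|u x| > c]].
Proof.
congr inf; apply/seteqP; have mu := class_repr u.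
split => c [c0 m]; split => //; apply: meagreS (meagreU m mu) => x /= cx;
  have [e|ne] := eqVneq (repr (bbm_class u) x) (u x); by [right|left; rewrite e in cx *].
Qed.

Lemma Linfty_norm_has_inf f :
  has_inf [set c | 0 <= c /\ meagre [set x | `|repr f x| > c]].
Proof.
split; last by exists 0 => c [].
have [M fM] := bbm_bounded (repr f); exists `|M|; split => //.
rewrite (_ : [set x | _] = set0); first exact: meagre0.
apply/seteqP; split => x //=.
by rewrite ltNge (le_trans (fM x) (ler_norm M)).
Qed.

Lemma Linfty_norm_ge0 f : 0 <= Linfty_norm f.
Proof. by apply: lb_le_inf; [exact: (Linfty_norm_has_inf f).1|move=> c []]. Qed.

Lemma Linfty_norm_meagre f : meagre [set x | `|repr f x| > Linfty_norm f].
Proof.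
pose F n := [set x | `|repr f x| > Linfty_norm f + n.+1%:R^-1].
apply: (@meagreS _ _ (\bigcup_n F n)).
  by move=> x /= /ltr_add_invr[n fn]; exists n.
apply: meagre_bigcup => n.
have n0 : 0 < n.+1%:R^-1 :> R by rewrite invr_gt0.
have [c [c0 mc] cn] := inf_adherent n0 (Linfty_norm_has_inf f).
by apply: meagreS mc => x /=; exact: lt_trans.
Qed.

Lemma class_norm_meagre u : meagre [set x | `|u x| > Linfty_norm (bbm_class u)].
Proof.
apply: meagreS (meagreU (Linfty_norm_meagre (bbm_class u)) (class_repr u)).
move=> x /= ux; have [e|ne] := eqVneq (repr (bbm_class u) x) (u x); last by right.
by left; rewrite e.
Qed.

Lemma class_norm_le u c : 0 <= c -> meagre [set x | `|u x| > c] ->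
  Linfty_norm (bbm_class u) <= c.
Proof.
move=> c0 mc; rewrite Linfty_normE; apply: ge_inf; last by split.
by exists 0 => y [].
Qed.

Lemma Linfty_normD f g : Linfty_norm (f + g) <= Linfty_norm f + Linfty_norm g.
Proof.
rewrite -{1}(repr_class f) -{1}(repr_class g) -bbm_classD.
apply: class_norm_le; first by rewrite addr_ge0 ?Linfty_norm_ge0.
apply: meagreS (meagreU (Linfty_norm_meagre f) (Linfty_norm_meagre g)) => x /= lt.
apply: contrapT => /not_orP[/negP + /negP]; rewrite -!leNgt => f1 g1.
move: lt; rewrite ltNge => /negP; apply.
by rewrite (le_trans (ler_normD _ _))// lerD.
Qed.

Lemma Linfty_normZ_le c f : Linfty_norm (c *: f) <= `|c| * Linfty_norm f.
Proof.
rewrite -{1}(repr_class f) -bbm_classZ.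
apply: class_norm_le; first by rewrite mulr_ge0 ?Linfty_norm_ge0.
apply: meagreS (Linfty_norm_meagre f) => x /=.
have -> : `|c *: repr f x| = `|c| * `|repr f x| by exact: normrM.
by rewrite !ltNge; apply: contraNN => ?; exact: ler_wpM2l.
Qed.

Lemma Linfty_norm_eq0 f : Linfty_norm f = 0 -> f = 0.
Proof.
move=> f0; rewrite -(repr_class f) -bbm_class0; apply/bbm_class_eq.
by apply: meagreS (Linfty_norm_meagre f) => x /=; rewrite f0 normr_gt0.
Qed.

Lemma Linfty_normZ c f : Linfty_norm (c *: f) = `|c| * Linfty_norm f.
Proof.
apply/eqP; rewrite eq_le Linfty_normZ_le/=.
have [->|c0] := eqVneq c 0; first by rewrite normr0 mul0r Linfty_norm_ge0.
rewrite -ler_pdivlMl ?normr_gt0// -normfV.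
by rewrite -{1}(scalerK c0 f); exact: Linfty_normZ_le.
Qed.

HB.instance Definition _ := @Lmodule_isNormed.Build R E Linfty_norm
  Linfty_normD Linfty_normZ Linfty_norm_eq0.

End Linfty_theory.

Section functionals_and_measures.
Context {R : realType} {K : topologicalType}.
Local Notation E := (Linfty R K).
Implicit Types (u v : K -> R) (A B : set K) (mu nu : set K -> R) (phi : E -> R).

(* The class of u; it is 0 when u is not bounded and measurable. *)
Definition hat u : E := bbm_class (insubd (0 : bbm R K) u).

(* The measure identified with the functional phi; only its values on sets with
   the property of Baire are meaningful. *)
Definition measure_of phi A : R := phi (hat \1_A).

Definition finitely_additive mu := forall A B,
  baire_set A -> baire_set B -> A `&` B = set0 -> mu (A `|` B) = mu A + mu B.

Definition bounded_measure mu := [/\ finitely_additive mu,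
  forall N, meagre N -> mu N = 0 &
  exists M, forall A, baire_set A -> `|mu A| <= M].

Definition baire_partition n (B : 'I_n -> set K) A :=
  [/\ forall i, baire_set (B i), trivIset setT B & \bigcup_i B i = A].

Definition total_variation mu A : R :=
  sup [set s | exists n (B : 'I_n -> set K),
    baire_partition B A /\ s = \sum_(i < n) `|mu (B i)|].

Definition countably_additive mu := forall A : nat -> set K,
  (forall n, baire_set (A n)) -> trivIset setT A ->
  series (mu \o A) @ \oo --> mu (\bigcup_n A n).

(* For positive mu and K compact Hausdorff the sup and inf below are those of
   nonempty bounded sets, so the conventions for the other sets do not matter. *)
Definition regular_pos mu := forall B, baire_set B ->
  sup [set mu C | C in [set C | compact C /\ C `<=` B]] = mu B /\
  inf [set mu U | U in [set U | open U /\ B `<=` U]] = mu B.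

(* |mu| in the lattice of measures is the total variation, see
   total_variation_modulus. *)
Definition regular mu := regular_pos (total_variation mu).

Lemma bbm_indic A : baire_set A -> (\1_A : K -> R) \in bbm_pred.
Proof.
move=> bA; apply/asboolP; split; last first.
  by exists 1 => x; rewrite indicE; case: (x \in A); rewrite ?normr1 ?normr0.
apply: baire_measurable_gt => a.
have [a0|a0] := ltP a 0.
  rewrite (_ : [set x | _] = setT); first exact: baire_setT.
  by apply/seteqP; split => x //= _; rewrite (lt_le_trans a0)// indicE.
have [a1|a1] := ltP a 1.
  rewrite (_ : [set x | _] = A) //; apply/seteqP; split => x /=.
    by rewrite indicE; case: (boolP (x \in A)) => [/set_mem//|_]; rewrite ltNge a0.
  by move=> Ax; rewrite indicE mem_set.
rewrite (_ : [set x | _] = set0); first exact: baire_set0.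
apply/seteqP; split => x //=; rewrite ltNge; apply/negP/negPn.
by rewrite (le_trans _ a1)// indicE lern1 leq_b1.
Qed.

Lemma hatE u (hu : u \in bbm_pred) : hat u = bbm_class (Bbm hu).
Proof. by congr bbm_class; apply: val_inj; rewrite insubdK. Qed.

Lemma hat_eq u v : u \in bbm_pred -> v \in bbm_pred ->
  hat u = hat v <-> meagre [set x | u x != v x].
Proof. by move=> hu hv; rewrite !hatE; exact: bbm_class_eq. Qed.

Lemma hat_le u v : u \in bbm_pred -> v \in bbm_pred ->
  hat u <= hat v <-> meagre [set x | u x > v x].
Proof. by move=> hu hv; rewrite !hatE; exact: class_le. Qed.

Lemma norm_hat u : u \in bbm_pred ->
  `|hat u| = inf [set c | 0 <= c /\ meagre [set x | `|u x| > c]].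
Proof. by move=> hu; rewrite hatE; exact: Linfty_normE. Qed.

Lemma hatD u v : u \in bbm_pred -> v \in bbm_pred ->
  hat (u + v) = hat u + hat v.
Proof.
move=> hu hv; have huv : u + v \in bbm_pred by exact: rpredD.
by rewrite !hatE -bbm_classD; congr bbm_class; exact: val_inj.
Qed.

Lemma bounded_measure_of (phi : {linear E -> R^o}) :
  continuous phi -> bounded_measure (measure_of phi).
Proof.
move=> cphi; split.
- move=> A B bA bB AB; rewrite /measure_of -raddfD -hatD ?bbm_indic//.
  congr (phi (hat _)); apply/funext => x; rewrite fctE !indicE in_setU.
  have := congr1 (fun C => x \in C) AB; rewrite /= in_setI in_set0.
  by case: (x \in A); case: (x \in B) => //= _; rewrite ?addr0 ?add0r.
- move=> N mN; rewrite /measure_of (_ : hat _ = 0) ?raddf0//.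
  have bN := bbm_indic (meagre_baire_set mN).
  rewrite hatE -bbm_class0; apply/bbm_class_eq; apply: meagreS mN => x /=.
  by rewrite indicE; case: (boolP (x \in N)) => [/set_mem//|_]; rewrite eqxx.
have [r r0 phir] : exists2 r, 0 < r & forall x, `|phi x| <= r * `|x|.
  by apply: pinfty_ex_gt0; apply/linear_boundedP;
    exact: (@continuous_linear_bounded _ _ _ _ phi (cphi 0)).
exists r => A bA; rewrite /measure_of (le_trans (phir _))// (ler_piMr (ltW r0))//.
rewrite hatE ?bbm_indic// => hA; apply: class_norm_le => //.
rewrite (_ : [set x | _] = set0); first exact: meagre0.
apply/seteqP; split => x //=; rewrite indicE; case: (x \in A) => /=;
  by rewrite ?normr1 ?normr0 ?ltxx // ltr10.
Qed.

End functionals_and_measures.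

Definition down_directed {F : porderZmodType} (D : set F) := D !=set0 /\
  forall f g, D f -> D g -> exists h, [/\ D h, h <= f & h <= g].

Definition order_continuous {R : realType} {F : porderZmodType} (phi : F -> R) :=
  forall D : set F, down_directed D -> infimums D 0 ->
  inf [set `|phi f| | f in D] = 0.

Section total_variation_modulus.
Context {R : realType} {K : topologicalType}.
Implicit Types (A B : set K) (mu nu : set K -> R).

Lemma finitely_additive0 mu : finitely_additive mu -> mu set0 = 0.
Proof.
move=> fa; apply: (addrI (mu set0)); rewrite addr0 -fa ?setU0 ?setI0//;
  exact: baire_set0.
Qed.

Lemma finitely_additive_sum mu n (B : 'I_n -> set K) (P : pred 'I_n) :
  finitely_additive mu -> (forall i, baire_set (B i)) -> trivIset setT B ->
  baire_set (\big[setU/set0]_(i < n | P i) B i) /\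
  mu (\big[setU/set0]_(i < n | P i) B i) = \sum_(i < n | P i) mu (B i).
Proof.
move=> fa bB tB; elim: (index_enum _) (index_enum_uniq 'I_n) => [_|i r ih /=].
  by rewrite !big_nil finitely_additive0//; split => //; exact: baire_set0.
move=> /andP[ir ur]; have [bU mU] := ih ur; rewrite !big_cons.
case: ifP => // Pi; split; first exact: baire_setU.
rewrite fa ?mU//; apply/seteqP; split => // x [Bix].
rewrite -bigcup_seq_cond => -[j /= /andP[jr _] Bjx].
have ij : i = j by apply: tB => //; exists x.
by move: ir; rewrite ij jr.
Qed.

Lemma bigcup_ord n (B : 'I_n -> set K) : \bigcup_i B i = \big[setU/set0]_(i < n) B i.
Proof.
rewrite -bigcup_seq; apply/seteqP; split => x [i _ Bix]; exists i => //=.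
exact: mem_index_enum.
Qed.

Lemma baire_partition_sum mu n (B : 'I_n -> set K) A :
  finitely_additive mu -> baire_partition B A -> mu A = \sum_(i < n) mu (B i).
Proof.
move=> fa [bB tB <-]; rewrite bigcup_ord.
by have [_ ->] := finitely_additive_sum xpredT fa bB tB.
Qed.

Lemma baire_partition1 A : baire_set A -> baire_partition (fun=> A : set K) (n := 1) A.
Proof.
move=> bA; split => //.
  by move=> i j _ _ _; rewrite (ord1 i) (ord1 j).
by apply/seteqP; split => x; [case|exists ord0].
Qed.

Section bounded.
Variable mu : set K -> R.
Hypothesis mu_bm : bounded_measure mu.
Local Notation V := (total_variation mu).

Let mu_add : finitely_additive mu. Proof. by case: mu_bm. Qed.

Lemma total_variation_ub : exists M, forall A n (B : 'I_n -> set K),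
  baire_partition B A -> \sum_(i < n) `|mu (B i)| <= M.
Proof.
have [_ _ [M muM]] := mu_bm; exists (M + M) => A n B [bB tB _].
rewrite (bigID (fun i => 0 <= mu (B i)))/=; apply: lerD.
  rewrite (eq_bigr (fun i => mu (B i))); last by move=> i /ger0_norm.
  have [bU <-] := finitely_additive_sum (fun i => 0 <= mu (B i)) mu_add bB tB.
  by rewrite (le_trans (ler_norm _))// muM.
rewrite (eq_bigr (fun i => - mu (B i))); last first.
  by move=> i; rewrite -ltNge => /ltW /ler0_norm.
rewrite sumrN.
have [bU <-] := finitely_additive_sum (fun i => ~~ (0 <= mu (B i))) mu_add bB tB.
by rewrite (le_trans (ler_norm _))// normrN muM.
Qed.

Lemma total_variation_has_sup A : baire_set A ->
  has_sup [set s | exists n (B : 'I_n -> set K),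
    baire_partition B A /\ s = \sum_(i < n) `|mu (B i)|].
Proof.
move=> bA; split.
  by exists (\sum_(i < 1) `|mu A|); exists 1%N, (fun=> A); split => //;
    exact: baire_partition1.
by have [M MP] := total_variation_ub; exists M => _ [n [B [pB ->]]]; exact: MP pB.
Qed.

Lemma total_variation_ge A n (B : 'I_n -> set K) : baire_set A ->
  baire_partition B A -> \sum_(i < n) `|mu (B i)| <= V A.
Proof.
move=> bA pB; apply: ub_le_sup; first exact: (total_variation_has_sup bA).2.
by exists n, B.
Qed.

Lemma total_variation_le A c : baire_set A ->
  (forall n (B : 'I_n -> set K), baire_partition B A ->
     \sum_(i < n) `|mu (B i)| <= c) -> V A <= c.
Proof.
move=> bA H; apply: ge_sup; first exact: (total_variation_has_sup bA).1.
by move=> _ [n [B [pB ->]]]; exact: H.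
Qed.

Lemma total_variation_norm A : baire_set A -> `|mu A| <= V A.
Proof.
by move=> bA; have := total_variation_ge bA (baire_partition1 bA); rewrite big_ord1.
Qed.

Lemma total_variation_add : finitely_additive V.
Proof.
move=> A B bA bB AB0; have bAB := baire_setU bA bB.
have disjAB x : A x -> B x -> False by move=> Ax Bx; rewrite -[False]/(set0 x) -AB0.
apply/eqP; rewrite eq_le; apply/andP; split.
  apply: total_variation_le => // n C [bC tC CAB].
  have pC D : baire_set D -> D `<=` A `|` B -> baire_partition (fun i => C i `&` D) D.
    move=> bD DAB; split.
    - by move=> i; exact: baire_setI.
    - by move=> i j _ _ [x [[Cix _] [Cjx _]]]; apply: tC => //; exists x.
    - by rewrite -setI_bigcupl CAB setIidr.
  have pA := pC A bA (@subsetUl _ _ _); have pB := pC B bB (@subsetUr _ _ _).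
  apply: le_trans (lerD (total_variation_ge bA pA) (total_variation_ge bB pB)).
  rewrite -big_split/=; apply: ler_sum => i _.
  have CE : C i = (C i `&` A) `|` (C i `&` B).
    by rewrite -setIUr setIidl// -CAB => x Cx; exists i.
  rewrite [X in mu X]CE mu_add ?ler_normD//; [exact: baire_setI..|].
  by rewrite setIACA AB0 setI0.
rewrite -lerBrDr; apply: total_variation_le => // n C [bC tC CA].
rewrite lerBrDr -lerBrDl; apply: total_variation_le => // m D [bD tD DB].
rewrite lerBrDl.
pose G (i : 'I_(n + m)) := match fintype.split i with inl j => C j | inr k => D k end.
have Gl j : G (lshift m j) = C j by rewrite /G -[lshift _ _]/(unsplit (inl j)) unsplitK.
have Gr k : G (rshift n k) = D k by rewrite /G -[rshift _ _]/(unsplit (inr k)) unsplitK.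
have CA' j x : C j x -> A x by rewrite -CA; exists j.
have DB' j x : D j x -> B x by rewrite -DB; exists j.
have pG : baire_partition G (A `|` B).
  split.
  - by move=> i; rewrite /G; case: fintype.split.
  - move=> i j _ _ [x []]; rewrite -(splitK i) -(splitK j).
    case: (fintype.split i) (fintype.split j) => [a|a] [b|b]; rewrite /unsplit ?Gl ?Gr => h1 h2.
    + by congr lshift; apply: tC => //; exists x.
    + by case: (disjAB x); [exact: CA' h1|exact: DB' h2].
    + by case: (disjAB x); [exact: CA' h2|exact: DB' h1].
    + by congr rshift; apply: tD => //; exists x.
  - apply/seteqP; split => x.
      move=> [i _]; rewrite -(splitK i); case: (fintype.split i) => a;
        rewrite /unsplit ?Gl ?Gr => h; [left; exact: CA' h|right; exact: DB' h].
    rewrite -{1}CA -{1}DB => -[] [i _ h].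
      by exists (lshift m i) => //; rewrite Gl.
    by exists (rshift n i) => //; rewrite Gr.
have := total_variation_ge bAB pG; rewrite big_split_ord/=.
by under eq_bigr do rewrite Gl; under [X in _ + X <= _]eq_bigr do rewrite Gr.
Qed.

Lemma bounded_measure_total_variation : bounded_measure V.
Proof.
split; first exact: total_variation_add.
  move=> N mN; have bN := meagre_baire_set mN; apply/eqP; rewrite eq_le; apply/andP; split.
    apply: total_variation_le => // n B [_ _ BN]; rewrite big1// => i _.
    have [_ mu0 _] := mu_bm; rewrite mu0 ?normr0//.
    by apply: meagreS mN; rewrite -BN => x Bx; exists i.
  exact: le_trans (total_variation_norm bN).
have [M MP] := total_variation_ub; exists M => A bA.
rewrite ger0_norm; last exact: le_trans (total_variation_norm bA).
by apply: total_variation_le => // n B; exact: MP.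
Qed.

(* The modulus of mu for the setwise order is its total variation. *)
Lemma total_variation_modulus :
  (forall A, baire_set A -> mu A <= V A /\ - mu A <= V A) /\
  (forall nu, bounded_measure nu ->
    (forall A, baire_set A -> mu A <= nu A /\ - mu A <= nu A) ->
    forall A, baire_set A -> V A <= nu A).
Proof.
split=> [A bA|nu [nu_add _ _] munu A bA].
  have := total_variation_norm bA; rewrite ler_norml => /andP[h1 h2].
  by split => //; rewrite lerNl.
apply: total_variation_le => // n B pB.
rewrite (baire_partition_sum nu_add pB); apply: ler_sum => i _.
have [bB _ _] := pB; have [h1 h2] := munu _ (bB i).
by rewrite ler_norml h1 andbT lerNl.
Qed.

End bounded.
End total_variation_modulus.

(* Main.v *)
(* Write V for the total variation of phi, seen as a measure.

   If phi is order continuous, then phi(A & B) tends to 0 along every downward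
   directed family of sets B whose infimum is null; testing this on a finite
   partition that nearly attains V shows that V also tends to 0.  Applied to the
   tails of a sequence of sets this gives countable additivity.  Applied to the
   sets U \ C, with C closed in the open set U, it gives inner regularity of
   open sets; hence nowhere dense sets, and by subadditivity meagre sets, have
   open neighbourhoods of small V, which yields regularity on all Baire sets.

   Conversely let D decrease to 0 and e > 0.  The open sets on which some f in D
   is at most e (off a meagre set) form a directed family, and their union W is
   dense: otherwise some nonzero multiple of the indicator of an open set would be
   a lower bound of D.  So V(W) = V(K), and by inner regularity and compactness
   some f in D has V{f > e} small, which makes phi(f) small. *)

Require Import Defs.
From mathcomp Require Import all_boot all_order all_algebra.
From mathcomp Require Import all_classical all_reals all_analysis lra.
(* Again, so that total_variation is not the one of functions of bounded
   variation. *)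
Require Import Defs.

Set Implicit Arguments.
Unset Strict Implicit.
Unset Printing Implicit Defensive.

Import Order.TTheory GRing.Theory Num.Theory.
Import numFieldNormedType.Exports.
Local Open Scope classical_set_scope.
Local Open Scope ring_scope.

(** * Compactness and Baire category *)

Lemma compact_directed_cover (T : topologicalType) (C : set T)
    (D : set (set T)) :
  compact C -> D !=set0 -> (forall U, D U -> open U) ->
  (forall U V, D U -> D V -> exists2 W, D W & U `|` V `<=` W) ->
  C `<=` \bigcup_(U in D) U -> exists2 U, D U & C `<=` U.
Proof.
move=> /compact_near_coveringP cC D0 oD dD CD.
(* [B U] is the tail of [D] above [U]. Near-covering compactness for the filter of tails yields one
   tail all of whose members contain [C]. *)
pose B U := [set V | D V /\ U `<=` V].
have FB : Filter (filter_from D B).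
  apply: filter_from_filter => // U V DU DV.
  have [W DW UVW] := dD _ _ DU DV; exists W => // X [DX WX].
  by split; split => // x ?; apply/WX/UVW; [left|right].
have := cC _ (filter_from D B) (fun U x => U x) FB.
case.
  move=> x /CD[U DU Ux]; exists (U, B U) => /=.
    by split; [apply: open_nbhs_nbhs; split => //; exact: oD|exists U].
  by move=> [y V] /= [Uy [_ UV]]; exact: UV.
by move=> U DU /(_ U) CU; exists U => //; apply: CU; split.
Qed.

Lemma compact_open_shrink (T : topologicalType) (U : set T) (x : T) :
  compact [set: T] -> hausdorff_space T -> open U -> U x ->
  exists V, [/\ open V, V x & closure V `<=` U].
Proof.
move=> cT hT oU Ux.
have [|V Vx VU] := @compact_regular T x setT hT cT filterT U.
  exact: open_nbhs_nbhs.
exists V^°; split; [exact: open_interior|exact: Vx|].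
by apply: subset_trans VU; apply: closureS; exact: interior_subset.
Qed.

(** If the intersection were empty, the complements would form a directed open cover, so one of them
    would be the whole space. *)
Lemma closed_nested_nonempty (T : topologicalType) (F : nat -> set T) :
  compact [set: T] -> (forall n, closed (F n)) -> (forall n, F n !=set0) ->
  (forall n, F n.+1 `<=` F n) -> \bigcap_n F n !=set0.
Proof.
move=> cT cF F0 dF; apply/set0P/eqP => F_0.
have dF2 n m : (n <= m)%N -> F m `<=` F n.
  elim: m => [|m ih]; first by rewrite leqn0 => /eqP ->.
  by rewrite leq_eqVlt => /predU1P[<-//|/ih nm] x /dF/nm.
have [||U V [n _ <-] [m _ <-]||U [n _ <-] TU] :=
    @compact_directed_cover T setT [set ~` F n | n in setT] cT.
- by exists (~` F 0%N), 0%N.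
- by move=> U [n _ <-]; exact: closed_openC.
- exists (~` F (maxn n m)); first by exists (maxn n m).
  by move=> x [] nF Fx; apply: nF; apply: dF2 Fx; [exact: leq_maxl|exact: leq_maxr].
- move=> x _; apply: contrapT => nx; have : set0 x => [|//].
  by rewrite -F_0 => n _; apply: contrapT => nF; apply: nx; exists (~` F n) => //; exists n.
by have [x /TU] := F0 n; apply.
Qed.

(** Baire category theorem: shrink [G] through nonempty open sets whose closures avoid [F 0], [F 1],
    ... in turn; compactness leaves a point of [G] in no [F n]. *)
Lemma open_meagre_set0 (T : topologicalType) (G : set T) :
  compact [set: T] -> hausdorff_space T -> open G -> meagre G -> G = set0.
Proof.
move=> cT hT oG [F [F0 GF]]; apply: contrapT => /eqP/set0P G0.
(* Keeping the hypotheses on [nU] inside the existential makes [g] total, so that [U] below is a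
   plain recursion. *)
have /choice[g gP] (nU : nat * set T) : exists V, open nU.2 -> nU.2 !=set0 ->
    [/\ open V, V !=set0, closure V `<=` nU.2 & closure V `&` F nU.1 = set0].
  case: nU => n U /=; have [oU|] := pselect (open U); last by exists U.
  have [U0|] := pselect (U !=set0); last by exists U.
  have [y [Uy Fy]] : U `\` closure (F n) !=set0.
    apply: contrapT => UF; have [x Ux] := U0.
    have : (closure (F n))^° x.
      apply: filterS (open_nbhs_nbhs (conj oU Ux)) => y Uy.
      by apply: contrapT => Fy; apply: UF; exists y.
    by rewrite F0.
  have [|V [oV Vy VU]] :=
      @compact_open_shrink T (U `\` closure (F n)) y cT hT _ (conj Uy Fy).
    by apply: openI => //; exact/closed_openC/closed_closure.
  exists V => _ _; split => //; [by exists y|by move=> x /VU[]|].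
  by rewrite -subset0 => x [/VU[_ +] Fx]; apply; exact: subset_closure.
pose U := fix U n := if n is m.+1 then g (m, U m) else G.
have UP n : open (U n) /\ U n !=set0.
  by elim: n => [//|n [oU nU]]; have [] := gP (n, U n) oU nU.
have US n : closure (U n.+1) `<=` U n /\ closure (U n.+1) `&` F n = set0.
  by have [oU nU] := UP n; have [] := gP (n, U n) oU nU.
(* The closures start at [U 1], because the closure of [U 0 = G] may leave [G]. *)
have [||||x Ux] := @closed_nested_nonempty T (fun n => closure (U n.+1)).
- exact: cT.
- by move=> n; exact: closed_closure.
- by move=> n; have [_ [x Ux]] := UP n.+1; exists x; exact: subset_closure.
- by move=> n x /(US n.+1).1 /subset_closure.
have : G x by apply: (US 0%N).1; exact: Ux.
rewrite GF => -[n _ Fx]; have := (US n).2; rewrite -subset0; apply.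
by split; [exact: Ux|exact: Fx].
Qed.

Lemma baire_set_open_part (T : topologicalType) (G A : set T) :
  baire_set G -> meagre (G `&` A) ->
  exists U, [/\ open U, meagre (G `+` U) & meagre (U `&` A)].
Proof.
move=> /baire_setP[U oU mGU] mGA; exists U; split => //.
apply: meagreS (meagreU mGA mGU) => x [Ux Ax].
by have [Gx|nGx] := pselect (G x); [left|right; right].
Qed.

(** * Order continuity of measures, countable additivity and total variation *)

Definition nonneg_measure {R : realType} {K : topologicalType}
    (mu : set K -> R) :=
  bounded_measure mu /\ forall A, baire_set A -> 0 <= mu A.

(* The last clause says that the indicators of the sets in D have infimum 0 in
   Linfty. *)
Definition order_null {K : topologicalType} (D : set (set K)) :=
  [/\ D !=set0, D `<=` baire_set,
      forall A B, D A -> D B -> exists2 C, D C & C `<=` A `&` B &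
      forall G, baire_set G -> (forall B, D B -> meagre (G `\` B)) -> meagre G].

(** Smallness is asked of all members below some [B0], so that the conditions for the finitely many
    cells [A] of a partition can be met at once. *)
Definition order_continuous_measure {R : realType} {K : topologicalType}
    (mu : set K -> R) :=
  forall D, order_null D -> forall A, baire_set A -> forall e, 0 < e ->
  exists2 B0, D B0 & forall B, D B -> B `<=` B0 -> `|mu (A `&` B)| < e.

Section baire_sets.
Context {R : realType} {K : topologicalType}.
Implicit Types (A B : set K) (mu : set K -> R).

Lemma baire_set_bigsetU n (A : nat -> set K) : (forall k, baire_set (A k)) ->
  baire_set (\big[setU/set0]_(k < n) A k).
Proof.
move=> bA; apply: (@big_ind _ baire_set) => //; first exact: baire_set0.
exact: baire_setU.
Qed.

Lemma closed_baire_set A : closed A -> baire_set A.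
Proof.
by move=> cA; rewrite -(setCK A); apply: baire_setC; apply: open_baire_set;
  exact: closed_openC.
Qed.

Lemma nonneg_total_variation mu : bounded_measure mu ->
  nonneg_measure (total_variation mu).
Proof.
move=> bm; split; first exact: bounded_measure_total_variation.
by move=> A bA; apply: le_trans (total_variation_norm bm bA).
Qed.

Lemma finitely_additiveDI mu A B : finitely_additive mu ->
  baire_set A -> baire_set B -> mu A = mu (A `&` B) + mu (A `\` B).
Proof.
move=> fa bA bB; rewrite -fa; [|exact: baire_setI|exact: baire_setD|].
  by rewrite setUIDK.
by rewrite setDE setIACA setICr setI0.
Qed.

Lemma nonneg_measure_le_meagre mu A B : nonneg_measure mu ->
  baire_set A -> baire_set B -> meagre (A `\` B) -> mu A <= mu B.
Proof.
move=> [[fa mu0 _] mu_ge0] bA bB mAB.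
rewrite (finitely_additiveDI fa bA bB) (mu0 _ mAB) addr0.
by rewrite (finitely_additiveDI fa bB bA) setIC lerDl mu_ge0//; exact: baire_setD.
Qed.

Lemma nonneg_measure_le mu A B : nonneg_measure mu ->
  baire_set A -> baire_set B -> A `<=` B -> mu A <= mu B.
Proof.
move=> nn bA bB AB; apply: nonneg_measure_le_meagre => //.
by move: AB; rewrite -setD_eq0 => ->; exact: meagre0.
Qed.

Lemma nonneg_measureU_le mu A B : nonneg_measure mu ->
  baire_set A -> baire_set B -> mu (A `|` B) <= mu A + mu B.
Proof.
move=> nn bA bB; have [[fa _ _] _] := nn.
rewrite (finitely_additiveDI fa (baire_setU bA bB) bA).
apply: lerD; apply: nonneg_measure_le => //.
- by apply: baire_setI => //; exact: baire_setU.
- by apply: baire_setD => //; exact: baire_setU.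
- by move=> x [[]].
Qed.

Lemma nonneg_measure_bigsetU_le mu n (A : nat -> set K) : nonneg_measure mu ->
  (forall k, baire_set (A k)) ->
  mu (\big[setU/set0]_(k < n) A k) <= \sum_(k < n) mu (A k).
Proof.
move=> nn bA; elim: n => [|n ih].
  by rewrite !big_ord0; have [[_ mu0 _] _] := nn; rewrite (mu0 _ (@meagre0 K)).
rewrite !big_ord_recr/=.
have bU := baire_set_bigsetU n bA.
by apply: le_trans (nonneg_measureU_le nn bU (bA n)) _; rewrite lerD2r.
Qed.

(** The tails have empty intersection, so a set almost contained in each of them is covered by
    countably many meagre sets. *)
Lemma order_null_tails (A : nat -> set K) : (forall n, baire_set (A n)) ->
  order_null [set \bigcup_k A k `\` \big[setU/set0]_(k < n) A k | n in setT].
Proof.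
move=> bA; split.
- by exists (\bigcup_k A k `\` \big[setU/set0]_(k < 0) A k), 0%N.
- move=> _ [n _ <-]; apply: baire_setD; first exact: baire_set_bigcup.
  exact: baire_set_bigsetU.
- move=> _ _ [n _ <-] [m _ <-].
  exists (\bigcup_k A k `\` \big[setU/set0]_(k < maxn n m) A k).
    by exists (maxn n m).
  rewrite -!bigcup_mkord => x [Ax nAx].
  split; split => // -[k /= kn Akx]; apply: nAx; exists k => //=.
    by rewrite leq_max kn.
  by rewrite leq_max kn orbT.
- move=> G bG mG.
  pose T n := \bigcup_k A k `\` \big[setU/set0]_(k < n) A k.
  apply: (@meagreS _ _ (\bigcup_n (G `\` T n))); last first.
    by apply: meagre_bigcup => n; apply: mG; exists n.
  move=> x Gx; have [[k _ Akx]|nAx] := pselect ((\bigcup_k A k) x).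
    exists k.+1 => //; split => // -[_]; apply; rewrite -bigcup_mkord.
    by exists k => /=.
  by exists 0%N => //; split => // -[].
Qed.

(** The error of the [n]-th partial sum is the measure of the [n]-th tail. *)
Lemma order_continuous_countably_additive mu : bounded_measure mu ->
  order_continuous_measure mu -> countably_additive mu.
Proof.
move=> [fa mu0 _] oc A bA tA.
have bU : baire_set (\bigcup_k A k) by exact: baire_set_bigcup.
apply/cvgrPdist_lt => e e0.
have [_ [N _ <-] NP] := oc _ (order_null_tails bA) _ bU _ e0.
exists N => // n /= Nn.
pose T := \bigcup_k A k `\` \big[setU/set0]_(k < n) A k.
rewrite (_ : _ - _ = mu (\bigcup_k A k `&` T)); last first.
  have bn := baire_set_bigsetU n bA.
  rewrite (finitely_additiveDI fa bU bn).
  rewrite (_ : _ `&` _ = \big[setU/set0]_(k < n) A k); last first.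
    apply/setIidr; rewrite -bigcup_mkord => x [k _ Akx]; by exists k.
  rewrite (setIidr (@subDsetl _ _ _)) addrAC.
  rewrite /series/= big_mkord.
  have [||_ ->] := @finitely_additive_sum R K mu n (fun i => A i) xpredT fa.
  - by move=> i; exact: bA.
  - by move=> i j _ _ Aij; apply: ord_inj; exact: tA Aij.
  - by rewrite subrr add0r.
apply: NP; first by exists n.
rewrite /T -!bigcup_mkord => x [Ax nAx]; split => // -[k /= kN Akx]; apply: nAx.
by exists k => //=; exact: leq_trans Nn.
Qed.

(** Partition [B0] to within [e / 2] of its variation, and take [B] in [D] with little mass in every
    cell. Cutting [B] out of the cells loses at most [e / 2], so the variation of the rest of [B0]
    is within [e] of the total; additivity bounds that of [B]. *)
Lemma order_continuous_total_variation mu : bounded_measure mu ->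
  order_continuous_measure mu ->
  forall D, order_null D -> forall e, 0 < e ->
  exists2 B, D B & total_variation mu B < e.
Proof.
move=> bm oc D nD e e0; have [[B0 DB0] bD dD _] := nD.
have nV := nonneg_total_variation bm; have [[faV _ _] _] := nV.
have bB0 := bD _ DB0; have e20 : 0 < e / 2 by rewrite divr_gt0.
have [_ [n [C [pC ->]]] VC] := sup_adherent e20 (total_variation_has_sup bm bB0).
have [bC tC CB0] := pC.
(* The divisor is [n.+1] since a partition of the empty set may have no cells. *)
have en0 : 0 < e / 2 / n.+1%:R by rewrite divr_gt0.
have /choice[F FP] i : exists F, D F /\ forall B, D B -> B `<=` F ->
    `|mu (C i `&` B)| < e / 2 / n.+1%:R.
  by have [F DF FP] := oc _ nD _ (bC i) _ en0; exists F.
have [B [DB BB0 BF]] : exists B, [/\ D B, B `<=` B0 & forall i, B `<=` F i].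
  have [B DB BF] : exists2 B, D B & forall i, i \in enum 'I_n -> B `<=` F i.
    elim: (enum 'I_n) => [|i s [B DB BF]]; first by exists B0.
    have [B' DB' B'F] := dD _ _ DB (FP i).1; exists B' => // j.
    rewrite inE => /predU1P[->|/BF jB] x /B'F[] // Bx _.
    exact: jB.
  have [B' DB' B'B] := dD _ _ DB DB0; exists B'; split => //.
    by move=> x /B'B[].
  by move=> i x /B'B[+ _]; apply: BF; rewrite mem_enum.
exists B => //; have bB := bD _ DB.
have pD : baire_partition (fun i => C i `\` B) (B0 `\` B).
  split.
  - by move=> i; exact: baire_setD.
  - by move=> i j _ _ [x [[Cix _] [Cjx _]]]; apply: tC => //; exists x.
  - by rewrite -CB0 setDE setI_bigcupl.
have := total_variation_ge bm (baire_setD bB0 bB) pD.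
move: VC; rewrite -/(total_variation mu B0) (finitely_additiveDI faV bB0 bB).
rewrite (setIidr BB0).
have : \sum_(i < n) `|mu (C i)| <=
    \sum_(i < n) `|mu (C i `\` B)| + \sum_(i < n) (e / 2 / n.+1%:R).
  rewrite -big_split/=; apply: ler_sum => i _; have [fa _ _] := bm.
  rewrite (finitely_additiveDI fa (bC i) bB) (le_trans (ler_normD _ _))//.
  by rewrite [leLHS]addrC lerD2l ltW// (FP i).2.
have : \sum_(i < n) (e / 2 / n.+1%:R) <= e / 2.
  rewrite sumr_const card_ord -[leLHS]mulr_natr -mulrA ler_piMr ?ltW//.
  by rewrite mulrC ltr_pdivrMr// mul1r ltr_nat.
lra.
Qed.

End baire_sets.

(** * Regularity from smallness along order null families *)

Section regularity.
Context {R : realType} {K : topologicalType}.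
Hypotheses (compactK : compact [set: K]) (hausdorffK : hausdorff_space K).
Implicit Types (A B C U N : set K).

(** Let [G] equal an open [W] up to a meagre set. Around a point of [U] and [W], choose an open [V]
    with closure inside both; testing [G] against [C = closure V] makes [V] meagre, contradicting
    the category theorem. *)
Lemma order_null_open_diff_closed U : open U ->
  order_null [set U `\` C | C in [set C | closed C /\ C `<=` U]].
Proof.
move=> oU; have bU := open_baire_set oU; split.
- by exists (U `\` set0), set0 => //; split => //; exact: closed0.
- by move=> _ [C [cC CU] <-]; exact: baire_setD bU (closed_baire_set cC).
- move=> _ _ [A [cA AU] <-] [B [cB BU] <-]; exists (U `\` (A `|` B)).
    exists (A `|` B) => //; split; first exact: closedU.
    by rewrite subUset.
  by rewrite setDUr.
- move=> G /baire_setP[W oW mGW] mG.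
  have mGU : meagre (G `\` U).
    rewrite -[U]setD0; apply: mG; exists set0 => //.
    by split => //; exact: closed0.
  apply: meagreS (meagreU mGU mGW) => x Gx.
  have [Ux|nUx] := pselect (U x); last by left.
  right; left; split => // Wx.
  have [V [oV Vx VUW]] :=
    compact_open_shrink compactK hausdorffK (openI oU oW) (conj Ux Wx).
  suff V0 : V = set0 by rewrite V0 in Vx.
  apply: (open_meagre_set0 compactK hausdorffK oV).
  have VU : closure V `<=` U by move=> y /VUW[].
  have mGV : meagre (G `\` (U `\` closure V)).
    by apply: mG; exists (closure V) => //; split => //; exact: closed_closure.
  apply: meagreS (meagreU mGW mGV) => y Vy.
  have [_ Wy] := VUW _ (subset_closure Vy).
  have [Gy|nGy] := pselect (G y); last by left; right.
  by right; split => // -[_]; apply; exact: subset_closure.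
Qed.

Variable V : set K -> R.
Hypothesis nnV : nonneg_measure V.
Hypothesis order_null_small :
  forall D, order_null D -> forall e, 0 < e -> exists2 B, D B & V B < e.

Lemma open_inner_closed U e : open U -> 0 < e ->
  exists C, [/\ closed C, C `<=` U & V (U `\` C) < e].
Proof.
move=> oU e0.
have [_ [C [cC CU] <-] VC] :=
  order_null_small (order_null_open_diff_closed oU) e0.
by exists C.
Qed.

(** Nearly fill the complement of [closure N] by a closed [C]. The complement of [C] exceeds the
    small remainder only by points of the null set [closure N]. *)
Lemma nowhere_dense_outer_open N e : nowhere_dense N -> 0 < e ->
  exists U, [/\ open U, N `<=` U & V U < e].
Proof.
move=> ndN e0; have cN : closed (closure N) by exact: closed_closure.
have oU := closed_openC cN.
have [C [cC CU VC]] := open_inner_closed oU e0.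
exists (~` C); split; first exact: closed_openC.
  by move=> x Nx Cx; exact: (CU _ Cx (subset_closure Nx)).
have oC := closed_openC cC.
apply: le_lt_trans VC; apply: nonneg_measure_le_meagre => //.
- exact: open_baire_set.
- by apply: baire_setD; [exact: open_baire_set|exact: closed_baire_set].
apply: nowhere_dense_meagre; apply: (@nowhere_denseS _ _ (closure N)).
  by move=> x [Cx nx]; apply: contrapT => Nx; apply: nx; split.
by rewrite /nowhere_dense -(closure_id _).1.
Qed.

(** Cover the pieces by open sets with geometrically decreasing bounds. Finite subadditivity
    controls the first [n] of them, and order nullity of the tails controls the rest of the
    union. *)
Lemma meagre_outer_open N e : meagre N -> 0 < e ->
  exists U, [/\ open U, N `<=` U & V U < e].
Proof.
move=> [F [ndF ->]] e0; have e20 : 0 < e / 2 by rewrite divr_gt0.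
have ek0 k : 0 < e / 2 / 2 ^+ k.+1 by rewrite divr_gt0// exprn_gt0.
have /choice[W WP] k := nowhere_dense_outer_open (ndF k) (ek0 k).
have bW k : baire_set (W k) by have [oW _ _] := WP k; exact: open_baire_set.
exists (\bigcup_k W k); split.
- by apply: bigcup_open => k _; have [] := WP k.
- by move=> x [k _ Fx]; exists k => //; have [_ + _] := WP k; exact.
have [_ [n _ <-]] := order_null_small (order_null_tails bW) e20.
set T := _ `\` _ => VT.
have bn := baire_set_bigsetU n bW.
have bT : baire_set T by apply: baire_setD => //; exact: baire_set_bigcup.
have : V (\bigcup_k W k) <= V (\big[setU/set0]_(k < n) W k) + V T.
  apply: le_trans (nonneg_measureU_le nnV bn bT).
  apply: nonneg_measure_le => //; first exact: baire_set_bigcup.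
    exact: baire_setU.
  by move=> x Wx; apply: contrapT => /not_orP[nWx]; apply; split.
(* The exact geometric partial sum is what makes the induction close. *)
have : V (\big[setU/set0]_(k < n) W k) <= \sum_(k < n) V (W k).
  exact: nonneg_measure_bigsetU_le nnV bW.
have : \sum_(k < n) V (W k) <= e / 2 - e / 2 / 2 ^+ n.
  elim: (n) => [|m ih]; first by rewrite big_ord0 expr0 divr1 subrr.
  rewrite big_ord_recr/=; have [_ _ /ltW] := WP m; move: ih.
  rewrite exprS invfM; set z := (2 ^+ m)^-1; lra.
have : 0 < e / 2 / 2 ^+ n by rewrite divr_gt0// exprn_gt0.
lra.
Qed.

(** Fill [U] by a closed [A] and cover [N] by a small open [W]: [A] minus [W] avoids [N], hence lies
    in [B], and misses only points of [W] and of [U] minus [A]. *)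
Lemma baire_inner_closed B e : baire_set B -> 0 < e ->
  exists C, [/\ closed C, C `<=` B & V (B `\` C) < e].
Proof.
move=> [U [N [oU mN ->]]] e0; have e20 : 0 < e / 2 by rewrite divr_gt0.
have [A [cA AU VA]] := open_inner_closed oU e20.
have [W [oW NW VW]] := meagre_outer_open mN e20.
have bB : baire_set (U `+` N) by exists U, N.
have bA := closed_baire_set cA; have bW := open_baire_set oW.
have bU := open_baire_set oU.
have cC : closed (A `\` W) by apply: closedI => //; exact: open_closedC.
exists (A `\` W); split => //.
  by move=> x [Ax nW]; left; split; [exact: AU|move=> /NW].
have bC := closed_baire_set cC.
apply: (@le_lt_trans _ _ (V ((U `\` A) `|` W))).
  apply: nonneg_measure_le => //; first exact: baire_setD.
    by apply: baire_setU => //; exact: baire_setD.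
  move=> x [Bx nAWx]; have [Wx|nWx] := pselect (W x); first by right.
  left; split; last by move=> Ax; apply: nAWx; split.
  by case: Bx => -[] // /NW.
have := nonneg_measureU_le nnV (baire_setD bU bA) bW; lra.
Qed.

(** Compact and closed sets coincide in [K], and outer approximation of [B] is inner approximation
    of its complement. *)
Lemma order_null_small_regular : regular_pos V.
Proof.
have faV : finitely_additive V by have [[]] := nnV.
have cptC C : closed C -> compact C.
  by move=> cC; exact: subclosed_compact compactK _.
have inner B e : baire_set B -> 0 < e ->
    exists C, [/\ closed C, C `<=` B & V B < V C + e].
  move=> bB e0; have [C [cC CB VBC]] := baire_inner_closed bB e0.
  exists C; split => //.
  rewrite (finitely_additiveDI faV bB (closed_baire_set cC)) (setIidr CB).
  by rewrite ltrD2l.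
move=> B bB; split; apply/eqP; rewrite eq_le; apply/andP; split.
- apply: ge_sup.
    by exists (V set0), set0 => //; split => //; exact: compact0.
  move=> _ [C [cC CB] <-]; apply: nonneg_measure_le => //.
  exact: closed_baire_set (compact_closed hausdorffK cC).
- apply/ler_addgt0Pr => e e0; have [C [cC CB /ltW VB]] := inner _ _ bB e0.
  apply: le_trans VB _; rewrite lerD2r; apply: ub_le_sup.
    exists (V B) => _ [A [cA AB] <-]; apply: nonneg_measure_le => //.
    exact: closed_baire_set (compact_closed hausdorffK cA).
  by exists C => //; split => //; exact: cptC.
- apply/ler_addgt0Pr => e e0.
  have [C [cC CB /ltW VB]] := inner _ _ (baire_setC bB) e0.
  have oU := closed_openC cC; have bU := open_baire_set oU.
  apply: (@le_trans _ _ (V (~` C))).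
    apply: ge_inf; last first.
      by exists (~` C) => //; split => // x Bx /CB.
    by exists 0 => _ [A [oA _] <-]; apply: nnV.2; exact: open_baire_set.
  have := finitely_additiveDI faV baire_setT bB.
  have := finitely_additiveDI faV baire_setT (closed_baire_set cC).
  by rewrite !setTI !setTD; lra.
- apply: lb_le_inf; first by exists (V setT), setT => //; split => //; exact: openT.
  move=> _ [U [oU BU] <-]; apply: nonneg_measure_le => //.
  exact: open_baire_set.
Qed.

End regularity.

(** * From order continuous functionals to measures *)

Section order_continuous_functionals.
Context {R : realType} {K : topologicalType}.
Local Notation E := (Linfty R K).
Implicit Types (phi : {linear E -> R^o}) (D : set (set K)) (A B : set K).

(** Order continuity only gives an infimum 0. To get eventual smallness, suppose it fails: the
    members of [D] with mass at least [e] on [A] are then cofinal, so their indicators on [A] still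
    decrease to 0, while [phi] stays at least [e] in absolute value. *)
Lemma order_continuous_measure_of phi : order_continuous phi ->
  order_continuous_measure (measure_of phi).
Proof.
move=> oc D [[B1 DB1] bD dD nD] A bA e e0; apply: contrapT => nB.
have large B : D B ->
    exists2 C, D C /\ C `<=` B & e <= `|measure_of phi (A `&` C)|.
  move=> DB; apply: contrapT => nC; apply: nB; exists B => // C DC CB.
  by rewrite ltNge; apply/negP => Ce; apply: nC; exists C.
pose large_set := [set C | D C /\ e <= `|measure_of phi (A `&` C)|].
pose H := [set (hat (\1_(A `&` C)) : E) | C in large_set].
have hatS B C : D B -> D C -> C `<=` B ->
    (hat \1_(A `&` C) : E) <= hat \1_(A `&` B).
  move=> DB DC CB; apply/hat_le.
  - exact/bbm_indic/baire_setI/bD.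
  - exact/bbm_indic/baire_setI/bD.
  rewrite (_ : [set x | _] = set0); first exact: meagre0.
  apply/seteqP; split => x //=; rewrite ltNge => /negP; apply.
  rewrite !indicE ler_nat.
  case: (boolP (x \in A `&` C)) => // /set_mem[Ax Cx].
  by rewrite mem_set//; split => //; exact: CB.
have dH : down_directed H.
  split.
    by have [C [DC _] Ce] := large _ DB1; exists (hat \1_(A `&` C)), C.
  move=> _ _ [B [DB _] <-] [C [DC _] <-].
  have [F DF FBC] := dD _ _ DB DC; have [G [DG GF] Ge] := large _ DF.
  exists (hat \1_(A `&` G)); split; first by exists G.
    by apply: hatS => // x /GF /FBC[].
  by apply: hatS => // x /GF /FBC[].
have iH : infimums H 0.
  split.
    move=> _ [C [DC _] <-]; rewrite -bbm_class0 hatE.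
      exact/bbm_indic/baire_setI/bD.
    move=> hA; apply/class_le.
    rewrite (_ : [set x | _] = set0); first exact: meagre0.
    by apply/seteqP; split => x //=; rewrite ltNge indicE ler0n.
  (* The set where a lower bound [g] is positive is almost contained in every member of [D], hence
     meagre. *)
  move=> g gH; rewrite -(repr_class g) -bbm_class0; apply/class_le.
  rewrite (_ : [set x | _] = [set x | 0 < repr g x]) //.
  apply: nD; first by apply: baire_measurable_lt; exact: bbm_measurable.
  move=> B DB; have [C [DC CB] Ce] := large _ DB.
  have : g <= hat \1_(A `&` C) by apply: gH; exists C.
  have hAC : (\1_(A `&` C) : K -> R) \in bbm_pred.
    exact/bbm_indic/baire_setI/bD.
  rewrite -{1}(repr_class g) hatE => /class_le; apply: meagreS => x [/= gx nBx].
  by rewrite indicE memNset// => -[_ /CB].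
have /eqP := oc H dH iH; apply/negP; rewrite gt_eqF//.
apply: (lt_le_trans e0); apply: lb_le_inf.
  by have [g Hg] := dH.1; exists `|phi g|, g.
by move=> _ [_ [C [DC Ce] <-] <-].
Qed.

End order_continuous_functionals.

(** * From regular measures to order continuous functionals *)

Section regular_functionals.
Context {R : realType} {K : topologicalType}.
Local Notation E := (Linfty R K).
Implicit Types (phi : {linear E -> R^o}) (f g : E) (u : bbm R K) (D : set E).
Implicit Types (A B : set K) (V : set K -> R).

Lemma bbm_sumE n (F : 'I_n -> bbm R K) x :
  (\sum_(i < n) F i) x = \sum_(i < n) F i x.
Proof. exact: (big_morph (fun u : bbm R K => u x)). Qed.

Lemma bbm_class_sum n (F : 'I_n -> bbm R K) :
  bbm_class (\sum_(i < n) F i) = \sum_(i < n) bbm_class (F i).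
Proof. exact: (big_morph _ (@bbm_classD R K) (@bbm_class0 R K)). Qed.

(** The sum is [e] times the number of multiples [e], ..., [n e] strictly below [t], that is, [t]
    rounded down to the grid. *)
Lemma staircase_approx n (e t : R) : 0 < e -> 0 <= t -> t <= n%:R * e + e ->
  `|t - \sum_(i < n) e * (i.+1%:R * e < t)%R%:R| <= e.
Proof.
move=> e0 t0; elim: n => [|n ih] te.
  by rewrite big_ord0 subr0 ger0_norm//; lra.
(* Either the top step is not reached and the induction hypothesis applies, or every step counts. *)
have [tn|tn] := leP t (n%:R * e + e).
  rewrite big_ord_recr/= [(_ < t)%R]ltNge (_ : (t <= _)%R) ?mulr0 ?addr0.
    exact: ih.
  by rewrite -natr1 mulrDl mul1r.
rewrite (eq_bigr (fun=> e)); last first.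
  move=> i _; rewrite (_ : (_ < t)%R) ?mulr1//; apply: le_lt_trans tn.
  by rewrite -natr1 mulrDl mul1r lerD2r ler_pM2r// ler_nat -ltnS.
rewrite sumr_const card_ord -[_ *+ n.+1]mulr_natl -natr1 mulrDl mul1r.
rewrite -natr1 mulrDl mul1r in te.
by rewrite ger0_norm; lra.
Qed.

(* Layer-cake: e times the sum of the indicators of the sets {f > i e},
   0 < i <= n, approximates f within e, and these sets lie in {f > e}. *)
Lemma functional_le_superlevel phi r n (e : R) f :
  continuous phi -> (forall g, `|phi g| <= r * `|g|) -> 0 <= r -> 0 < e ->
  0 <= f -> meagre [set x | repr f x > n%:R * e + e] ->
  `|phi f| <=
    r * e + n%:R * e * total_variation (measure_of phi) [set x | e < repr f x].
Proof.
move=> cphi phir r0 e0 f0 fn; set V := total_variation _.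
have bm := bounded_measure_of cphi.
have nn := nonneg_total_variation bm.
pose A (i : 'I_n) := [set x | i.+1%:R * e < repr f x].
have bA i : baire_set (A i) by apply: baire_measurable_lt; exact: bbm_measurable.
pose s := \sum_(i < n) e *: Bbm (bbm_indic (R := R) (bA i)).
have sE x : s x = \sum_(i < n) e * (i.+1%:R * e < repr f x)%R%:R.
  rewrite bbm_sumE; apply: eq_bigr => i _; rewrite bbmZE /= indicE.
  by congr (_ * (nat_of_bool _)%:R); apply/idP/idP => [/set_mem|?]; last exact/mem_set.
have phis : `|phi (bbm_class s)| <= n%:R * e * V [set x | e < repr f x].
  have phiZ c g : phi (c *: g) = c * phi g by exact: linearZ_LR.
  have tv i : `|phi (hat \1_(A i))| <= V (A i).
    by have := total_variation_norm bm (bA i); rewrite /measure_of.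
  rewrite bbm_class_sum linear_sum (le_trans (ler_norm_sum _ _ _))//.
  rewrite -mulrA mulr_natl -[n in _ *+ n]card_ord -sumr_const.
  apply: ler_sum => i _; rewrite bbm_classZ phiZ normrM (ger0_norm (ltW e0)).
  apply: ler_wpM2l; first exact: ltW.
  rewrite -hatE; apply: (le_trans (tv i)).
  apply: nonneg_measure_le => //.
    by apply: baire_measurable_lt; exact: bbm_measurable.
  move=> x /=; apply: le_lt_trans; apply: ler_peMl; first exact: ltW.
  by rewrite ler1n.
have fs : `|f - bbm_class s| <= e.
  have -> : f - bbm_class s = bbm_class (repr f - s).
    by rewrite bbm_classD repr_class -[- s]scaleN1r bbm_classZ scaleN1r.
  apply: class_norm_le; first exact: ltW.
  have f0' : meagre [set x | 0 > repr f x].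
    by apply/(class_le 0); rewrite bbm_class0 repr_class.
  apply: meagreS (meagreU fn f0') => x /= fx.
  apply: contrapT => /not_orP[/negP + /negP]; rewrite -!leNgt => f1 f2.
  have : e < `|repr f x - s x| by exact: fx.
  by rewrite sE ltNge staircase_approx.
rewrite -[f in leLHS](subrK (bbm_class s)) raddfD/= (le_trans (ler_normD _ _))// lerD//.
by rewrite (le_trans (phir _))// ler_wpM2l.
Qed.

(** A Dini argument: on a dense open set, each point has a neighbourhood where some [f] in [D] is at
    most [e] off a meagre set; compactness and directedness let one [f] serve outside a set of
    measure below [d]. *)
Lemma directed_superlevel_small V D e d :
  compact [set: K] -> hausdorff_space K -> nonneg_measure V -> regular_pos V ->
  down_directed D -> infimums D 0 -> 0 < e -> 0 < d ->
  exists2 f, D f & V [set x | e < repr f x] < d.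
Proof.
move=> cK hK nnV rV [[f0 Df0] dD] [D0 Dinf] e0 d0.
have [[faV V0 _] _] := nnV.
have bS f a : baire_set [set x | a < repr f x].
  by apply: baire_measurable_lt; exact: bbm_measurable.
pose H := [set G | open G /\ exists2 f, D f & meagre (G `&` [set x | e < repr f x])].
pose W := \bigcup_(G in H) G.
have oW : open W by apply: bigcup_open => G [].
(* For [f] in [D], the set where [f] is at most [e] is almost an open [U]. The part of [U] in [G]
   belongs to [H], so it lies in [W] and is empty. Hence [e] times the indicator of [G] is a lower
   bound of [D]. *)
have interior_meagre : meagre (~` W)^°.
  pose G : set K := (~` W)^°; rewrite -/G; have oG : open G by exact: open_interior.
  have bG := open_baire_set oG.
  pose v : bbm R K := e *: Bbm (bbm_indic (R := R) bG).
  have vE x : v x = e * (x \in G)%:R by rewrite bbmZE /= indicE.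
  have : bbm_class v <= 0.
    apply: Dinf => f Df; rewrite -(repr_class f); apply/class_le.
    have f_ge0 : meagre [set x | 0 > repr f x].
      apply/(class_le 0); rewrite bbm_class0 repr_class; exact: D0.
    have /baire_setP[U oU mU] := baire_setC (bS f e).
    have HGU : H (G `&` U).
      split; first exact: openI.
      exists f => //; apply: meagreS mU => x [[_ Ux] fx]; right.
      by split => // /(_ fx).
    apply: meagreS (meagreU mU f_ge0) => x.
    rewrite -[_ x]/(is_true (repr f x < v x)) vE => fx.
    have [Gx|nGx] := pselect (G x); last first.
      by right; move: fx; rewrite memNset// mulr0.
    left; left; move: fx; rewrite mem_set// mulr1 => fe; split.
      by move/(lt_trans fe); rewrite ltxx.
    move=> Ux; apply: (interior_subset Gx).
    by exists (G `&` U).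
  rewrite -bbm_class0 => /class_le; apply: meagreS => x Gx.
  by rewrite -[_ x]/(is_true (0 < v x)) vE mem_set// mulr1.
have ndW : nowhere_dense (~` W).
  rewrite /nowhere_dense -(closure_id _).1; last exact: open_closedC.
  by apply: (open_meagre_set0 cK hK) => //; exact: open_interior.
have bW := open_baire_set oW.
have VW : V setT = V W.
  rewrite (finitely_additiveDI faV baire_setT bW) setTI setTD.
  by rewrite (V0 (~` W)) ?addr0//; exact: nowhere_dense_meagre.
have hs : has_sup [set V C | C in [set C | compact C /\ C `<=` W]].
  split; first by exists (V set0), set0 => //; split => //; exact: compact0.
  exists (V W) => _ [C [cC CW] <-]; apply: nonneg_measure_le => //.
  exact: closed_baire_set (compact_closed hK cC).
have [_ [C [cC CW] <-]] := sup_adherent d0 hs.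
rewrite (rV _ bW).1 -VW => VC.
have [||G1 G2 [oG1 [f1 Df1 m1]] [oG2 [f2 Df2 m2]]||G [oG [f Df mG]] CG] :=
    @compact_directed_cover K C H cC.
- by exists set0; split; [exact: open0|exists f0 => //; rewrite set0I; exact: meagre0].
- by move=> G [].
- have [f [Df ff1 ff2]] := dD _ _ Df1 Df2.
  exists (G1 `|` G2) => //; split; first exact: openU.
  exists f => //; move: ff1 ff2.
  rewrite -(repr_class f) -(repr_class f1) -(repr_class f2).
  move=> /class_le ff1 /class_le ff2; rewrite repr_class.
  apply: meagreS (meagreU (meagreU m1 m2) (meagreU ff1 ff2)) => x /= [G12 fx].
  apply: contrapT => /not_orP[/not_orP[nG1 nG2] /not_orP[/negP + /negP]].
  rewrite -!leNgt => l1 l2; case: G12 => ?.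
    by apply: nG1; split => //; exact: lt_le_trans l1.
  by apply: nG2; split => //; exact: lt_le_trans l2.
- exact: CW.
exists f => //; have bC := closed_baire_set (compact_closed hK cC).
(* The superlevel set of [f] almost misses [G], which contains [C]. *)
have bG := open_baire_set oG.
apply: (@le_lt_trans _ _ (V (~` C))).
  apply: nonneg_measure_le_meagre => //; first exact: baire_setC.
  apply: meagreS mG => x [fx /contrapT Cx]; split => //; exact: CG.
have := finitely_additiveDI faV baire_setT bC.
by rewrite setTI setTD; lra.
Qed.

(** Go below two elements of [D]: [f0] bounds the number of layers, [f1] makes the superlevel set
    small. The two terms of the layer-cake bound are then at most [d / 2] each. *)
Lemma regular_order_continuous phi :
  compact [set: K] -> hausdorff_space K -> continuous phi ->
  regular (measure_of phi) -> order_continuous phi.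
Proof.
move=> cK hK cphi reg D dD iD.
have bm := bounded_measure_of cphi.
have nn := nonneg_total_variation bm.
have [r r0 phir] : exists2 r, 0 < r & forall x, `|phi x| <= r * `|x|.
  by apply: pinfty_ex_gt0; apply/linear_boundedP;
    exact: (@continuous_linear_bounded _ _ _ _ phi (cphi 0)).
have [[f0 Df0] dD'] := dD.
have lb0 : lbound [set `|phi f| | f in D] 0 by move=> _ [f _ <-].
apply/eqP; rewrite eq_le; apply/andP; split; last first.
  by apply: lb_le_inf => //; exists `|phi f0|, f0.
apply/ler_addgt0Pr => d d0; rewrite add0r.
pose e := d / 2 / r; have e0 : 0 < e by rewrite !divr_gt0.
(* [n] depends on [f0] alone, so [d'] may depend on [n] before [f1] is chosen. *)
pose n := (Num.truncn (`|f0| / e)).+1.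
have fn : `|f0| <= n%:R * e.
  by rewrite -ler_pdivrMr// ltW// /n truncnS_gt.
pose d' := d / 2 / (n%:R * e).
have ne0 : 0 < n%:R * e by rewrite mulr_gt0// ltr0n.
have d'0 : 0 < d' by rewrite !divr_gt0.
have [f1 Df1 Vf1] := directed_superlevel_small cK hK nn reg dD iD e0 d'0.
have [f [Df ff0 ff1]] := dD' _ _ Df0 Df1.
apply: (@le_trans _ _ `|phi f|).
  by apply: ge_inf; [exists 0|exists f].
have mf0 : meagre [set x | repr f x > repr f0 x] by apply/class_le; rewrite !repr_class.
have mf1 : meagre [set x | repr f x > repr f1 x] by apply/class_le; rewrite !repr_class.
have := @functional_le_superlevel phi r n e f cphi phir (ltW r0) e0.
have fge0 : 0 <= f by apply: iD.1.
have mfn : meagre [set x | repr f x > n%:R * e + e].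
  apply: meagreS (meagreU mf0 (Linfty_norm_meagre f0)) => x /= fx.
  apply: contrapT => /not_orP[/negP + /negP]; rewrite -!leNgt => l1 l2.
  have := ler_norm (repr f0 x); move: fn; rewrite -[`|f0|]/(Linfty_norm f0); lra.
move=> /(_ fge0 mfn) H; apply: le_trans H _.
have bS g a : baire_set [set x | a < repr g x].
  by apply: baire_measurable_lt; exact: bbm_measurable.
have : total_variation (measure_of phi) [set x | e < repr f x] <=
    total_variation (measure_of phi) [set x | e < repr f1 x].
  apply: nonneg_measure_le_meagre => //; apply: meagreS mf1 => x /= [fx nf1x].
  by apply: le_lt_trans fx; rewrite leNgt; apply/negP.
move=> /le_lt_trans/(_ Vf1) /ltW /(ler_wpM2l (ltW ne0)).
rewrite /d' [X in _ <= X]mulrC divfK ?gt_eqF//.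
have -> : r * e = d / 2 by rewrite mulrC divfK ?gt_eqF.
lra.
Qed.

End regular_functionals.

Theorem theorem5p2 (R : realType) (K : topologicalType)
    (compactK : compact [set: K]) (hausdorffK : hausdorff_space K)
    (phi : {linear Linfty R K -> R^o}) (cphi : continuous phi) :
  order_continuous phi <->
  countably_additive (measure_of phi) /\ regular (measure_of phi).
Proof.
split=> [oc|[_ reg]]; last exact: regular_order_continuous.
have bm := bounded_measure_of cphi.
have ocm := order_continuous_measure_of oc.
split; first exact: order_continuous_countably_additive.
apply: order_null_small_regular => //; first exact: nonneg_total_variation.
exact: order_continuous_total_variation.
Qed.
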